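(* Let $k\ge1$ be an integer and let $\vec G=(V,\vec E)$ be a directed graph whose underlying undirected graph is $6k$-edge-connected. Then for every $\mathbb{Z}_{2k+1}$-boundary $\beta$, $\vec G$ has a $\mathbb{Z}_{2k+1}$-flow $f$ with boundary $\beta$ such that $f(\vec e)\in\{0,1\}\pmod{2k+1}$ for every $\vec e\in\vec E$.
   Context: Graphs are finite and may have multiple edges but no loops. A $\mathbb{Z}_{2k+1}$-boundary is a map $\beta:V\to\mathbb{Z}_{2k+1}$ with $\sum_{v\in V}\beta(v)\equiv0\pmod{2k+1}$. For $v\in V$, $\delta^+_{\vec G}(v)$ (resp. $\delta^-_{\vec G}(v)$) is the set of arcs leaving (resp. entering) $v$. A $\mathbb{Z}_{2k+1}$-flow with boundary $\beta$ is a map $f:\vec E\to\mathbb{Z}_{2k+1}$ with $\sum_{\vec e\in\delta^+_{\vec G}(v)}f(\vec e)-\sum_{\vec e\in\delta^-_{\vec G}(v)}f(\vec e)\equiv\beta(v)\pmod{2k+1}$ for every $v\in V$. *)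

(* Defs.v *)
From mathcomp Require Import all_boot all_order all_algebra.
Set Implicit Arguments. Unset Strict Implicit. Unset Printing Implicit Defensive.
Import GRing.Theory.
Local Open Scope ring_scope.

(* A directed multigraph (no loops) on vertex set V with arc set E:
   arc e goes from [tail e] to [head e]. *)
Definition loopless (V E : finType) (tail head : E -> V) : Prop :=
  forall e : E, tail e != head e.

Definition adj_minus (V E : finType) (tail head : E -> V) (F : {set E}) : rel V :=
  fun x y => [exists e, (e \notin F) &&
     (((tail e == x) && (head e == y)) || ((tail e == y) && (head e == x)))].

Definition ug_connected_minus (V E : finType) (tail head : E -> V) (F : {set E}) : Prop :=
  forall x y : V, connect (adj_minus tail head F) x y.

Definition edge_connected (V E : finType) (tail head : E -> V) (m : nat) : Prop :=
  forall F : {set E}, (#|F| < m)%N -> ug_connected_minus tail head F.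

Definition is_boundary (n : nat) (V : finType) (beta : V -> 'Z_n) : Prop :=
  \sum_(v : V) beta v = 0.

Definition is_flow_with_boundary (n : nat) (V E : finType) (tail head : E -> V)
    (f : E -> 'Z_n) (beta : V -> 'Z_n) : Prop :=
  forall v : V,
    \sum_(e : E | tail e == v) f e - \sum_(e : E | head e == v) f e = beta v.

(* Main.v *)
Require Import Defs.
From mathcomp Require Import all_boot all_order all_algebra.
From mathcomp Require Import zify.
Set Implicit Arguments. Unset Strict Implicit. Unset Printing Implicit Defensive.
Import Order.TTheory GRing.Theory Num.Theory.
Local Open Scope ring_scope.

(** Following Lovász, Thomassen, Wu and Zhang, a flow with values in {0, 1} is an
    orientation with prescribed net outdegrees modulo [4k + 2], and one proves a
    stronger statement by induction, in which the edges at one extra vertex z0 are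
    already directed.  The hypothesis is that every proper vertex set [A] has
    degree at least [4k] plus the distance from its balance to the multiples of
    [4k + 2], except possibly for one vertex of balance 0, while z0 has degree at
    most [4k] plus the corresponding distance.  If the bound is tight for some [A]
    with at least two vertices, contract [A], then orient the inside of [A] with
    its outside contracted to z0.  By parity every such [A] otherwise has slack 2,
    so only single vertices matter.  At the exceptional vertex one lifts pairs of
    edges until all its remaining edges are parallel.  If no vertex has balance 0,
    one directs and deletes an edge, possibly adding arcs at z0, so that the
    distances drop along with the degrees. *)

(** * Distance to the nearest multiple of 4k + 2 *)

Definition modulus (k : nat) : int := (4 * k + 2)%N.

(* Distance from [z] to the nearest multiple of [4k + 2]. *)
Definition residue_norm (k : nat) (z : int) : int :=
  Num.min (z %% modulus k)%Z (modulus k - (z %% modulus k)%Z).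

Section ResidueNorm.
Variable k : nat.
Local Notation M := (modulus k).
Local Notation nrm := (residue_norm k).

Lemma modulus_gt0 : 0 < M.
Proof. by rewrite /modulus; lia. Qed.

Lemma residue_norm_le (z j : int) : nrm z <= `|z - j * M|.
Proof.
rewrite /residue_norm; have M0 := modulus_gt0.
have := divz_eq z M; have := modz_ge0 z (lt0r_neq0 M0).
have := ltz_pmod z M0.
set r := (z %% M)%Z; set d := (z %/ M)%Z => rM r0 ->.
have -> : d * M + r - j * M = (d - j) * M + r by rewrite mulrBl addrAC.
case: (lerP 0 (d - j)) => dj.
  have : 0 <= (d - j) * M by apply: mulr_ge0 => //; lia.
  by move: (_ * M) => w; lia.
have : (d - j) * M <= -1 * M by rewrite ler_pM2r //; lia.
by move: (_ * M) => w; lia.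
Qed.

(** Together with [residue_norm_le] this makes [nrm z] the minimum of |z - jM| over all j; symmetry,
    subadditivity and parity follow from that form. *)
Lemma residue_norm_attained (z : int) : exists j, nrm z = `|z - j * M|.
Proof.
rewrite /residue_norm; have M0 := modulus_gt0.
have := divz_eq z M; have := modz_ge0 z (lt0r_neq0 M0).
have := ltz_pmod z M0.
set r := (z %% M)%Z; set d := (z %/ M)%Z => rM r0 ->.
case: (lerP r (M - r)) => rr.
  by exists d; rewrite addrAC subrr add0r; lia.
exists (d + 1); rewrite mulrDl mul1r; move: (d * M) => w; lia.
Qed.

Lemma residue_norm_ge0 z : 0 <= nrm z.
Proof. by have [j ->] := residue_norm_attained z. Qed.

Lemma residue_norm_max (z : int) : nrm z <= (2 * k + 1)%:Z.
Proof. by rewrite /residue_norm /modulus; lia. Qed.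

Lemma residue_norm_dvd x y : (M %| x - y)%Z -> nrm x = nrm y.
Proof.
case/dvdzP=> i xy; apply: le_anti; apply/andP; split.
  have [j ->] := residue_norm_attained y; have := residue_norm_le x (i + j).
  by rewrite mulrDl; move: xy; move: (i * M) (j * M); lia.
have [j ->] := residue_norm_attained x; have := residue_norm_le y (j - i).
by rewrite mulrBl; move: xy; move: (i * M) (j * M); lia.
Qed.

Lemma residue_normN z : nrm (- z) = nrm z.
Proof.
suff le y : nrm (- y) <= nrm y by apply: le_anti; rewrite le /= -{1}[z]opprK le.
have [j ->] := residue_norm_attained y; have := residue_norm_le (- y) (- j).
by rewrite mulNr; move: (j * M); lia.
Qed.

Lemma residue_norm_shift x y : nrm (x + y) <= nrm x + `|y|.
Proof.
have [j ->] := residue_norm_attained x; have := residue_norm_le (x + y) j.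
by move: (j * M); lia.
Qed.

Lemma residue_normD x y : nrm (x + y) <= nrm x + nrm y.
Proof.
have [i ->] := residue_norm_attained x; have [j ->] := residue_norm_attained y.
have := residue_norm_le (x + y) (i + j); rewrite mulrDl.
by move: (i * M) (j * M); lia.
Qed.

(** Since 4k + 2 is even, neither subtracting a multiple of it nor taking an absolute value changes
    the parity. *)
Lemma residue_norm_parity z : (2%:Z %| nrm z - z)%Z.
Proof.
have [j ->] := residue_norm_attained z; rewrite /modulus; apply/dvdzP.
have -> : j * (4 * k + 2)%N = j * (2 * k + 1)%N * 2 by lia.
move: (j * _) => w.
by case: (lerP 0 (z - w * 2)) => h; [exists (- w) | exists (w - z)]; lia.
Qed.

Lemma residue_norm_small (z : int) : 0 <= z <= (2 * k + 1)%:Z -> nrm z = z.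
Proof.
move=> h; rewrite /residue_norm modz_small; move: h; rewrite /modulus; lia.
Qed.

Lemma residue_norm_large (z : int) : (2 * k + 1)%:Z <= z <= M -> nrm z = M - z.
Proof.
move=> h; rewrite -residue_normN -(@residue_norm_dvd (M - z)).
  by apply: residue_norm_small; move: h; rewrite /modulus; lia.
by rewrite opprK subrK.
Qed.

End ResidueNorm.

(** * Configurations and the induction invariant *)

(* A graph together with a virtual vertex z0 whose arcs are already directed:
   [inz v] arcs go from z0 to [v] and [outz v] arcs go from [v] to z0.  The other
   edges are to be directed so that each [v] has net outdegree [dem v] modulo
   [4k + 2] among them. *)
Record config (V E : finType) := Config {
  src : E -> V;
  tgt : E -> V;
  verts : {set V};
  edges : {set E};
  dem : V -> int;
  inz : V -> int;
  outz : V -> int }.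

Definition total (V : finType) (f : V -> int) (A : {set V}) : int :=
  \sum_(v in A) f v.

Definition crosses (V : finType) (x y : V) (A : {set V}) : int :=
  ((x \in A) (+) (y \in A) : nat)%:Z.

Definition direction (b : bool) : int := if b then 1 else -1.

Section Configurations.
Variables (V E : finType) (k : nat).
Local Notation M := (modulus k).
Local Notation nrm := (residue_norm k).
Implicit Types (G : config V E) (A B X : {set V}) (o : E -> bool).

Definition cut G A : int := \sum_(e in edges G) crosses (src G e) (tgt G e) A.

(** The net outdegree required of [A] when the arcs at z0 are counted along with the edges. *)
Definition balance G A : int :=
  total (dem G) A + total (outz G) A - total (inz G) A.

Definition degree G A : int := cut G A + total (inz G) A + total (outz G) A.

Definition net G o (v : V) : int :=
  \sum_(e in edges G)
     direction (o e) * ((src G e == v)%:Z - (tgt G e == v)%:Z).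

Definition orientable G : Prop :=
  exists o, forall v, v \in verts G -> (M %| net G o v - dem G v)%Z.

(* [X] is empty or an exceptional vertex of balance 0 modulo [4k + 2], for which
   the degree condition is waived. *)
Record valid G X : Prop := Valid {
  src_verts : forall e, e \in edges G -> src G e \in verts G;
  tgt_verts : forall e, e \in edges G -> tgt G e \in verts G;
  inz_ge0 : forall v, 0 <= inz G v;
  outz_ge0 : forall v, 0 <= outz G v;
  dem_verts : (M %| total (dem G) (verts G))%Z;
  dem_parity : forall A, A \subset verts G ->
    (2%:Z %| total (dem G) A - cut G A)%Z;
  z0_degree : total (inz G) (verts G) + total (outz G) (verts G) <=
    (4 * k)%:Z + nrm (total (inz G) (verts G) - total (outz G) (verts G));
  degree_ge : forall A, A \proper verts G -> A != set0 -> A != X ->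
    (4 * k)%:Z + nrm (balance G A) <= degree G A;
  exception_card : (#|X| <= 1)%N;
  exception_balance : (M %| balance G X)%Z }.

(** The degree condition with 2 to spare. A step whose loss of degree and gain of distance add up to
    at most 2 is then harmless for sets of two or more vertices. *)
Definition slack G : Prop := forall A, A \proper verts G -> (1 < #|A|)%N ->
  (4 * k + 2)%:Z + nrm (balance G A) <= degree G A.

Lemma total1 (f : V -> int) x : total f [set x] = f x.
Proof. by rewrite /total big_set1. Qed.

Lemma total0 (f : V -> int) : total f set0 = 0.
Proof. by rewrite /total big_set0. Qed.

Lemma total_add (f g : V -> int) A :
  total (fun v => f v + g v) A = total f A + total g A.
Proof. by rewrite /total big_split. Qed.

Lemma total_indicator (a : int) x A :
  total (fun v => a * (v == x)%:Z) A = a * (x \in A)%:Z.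
Proof.
rewrite /total -big_distrr /=; congr (_ * _).
case: (boolP (x \in A)) => xA.
  rewrite (bigD1 x) //= eqxx big1 ?addr0 // => v /andP[_ /negPf-> //].
by rewrite big1 // => v vA; case: eqP => // vx; rewrite -vx vA in xA.
Qed.

Lemma total_setD (f : V -> int) A B : B \subset A ->
  total f A = total f B + total f (A :\: B).
Proof.
move=> BA; rewrite /total (big_setID B) /=; congr (_ + _).
by apply: eq_bigl => v; rewrite inE andbC; case: (boolP (v \in B)) => //= /(subsetP BA)->.
Qed.

Lemma total_ge0 (f : V -> int) A : (forall v, 0 <= f v) -> 0 <= total f A.
Proof. by move=> f0; apply: sumr_ge0. Qed.

Lemma total_net G o A : total (net G o) A =
  \sum_(e in edges G)
     direction (o e) * ((src G e \in A)%:Z - (tgt G e \in A)%:Z).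
Proof.
rewrite /total /net exchange_big /=; apply: eq_bigr => e _.
rewrite -big_distrr /= big_split /= sumrN; congr (_ * (_ - _)).
  have := total_indicator 1 (src G e) A; rewrite mul1r => <-.
  by apply: eq_bigr => v _; rewrite mul1r eq_sym.
have := total_indicator 1 (tgt G e) A; rewrite mul1r => <-.
by apply: eq_bigr => v _; rewrite mul1r eq_sym.
Qed.

Lemma balanceD G A B : B \subset A ->
  balance G A = balance G B + balance G (A :\: B).
Proof.
by move=> BA; rewrite /balance !(total_setD _ BA); lia.
Qed.

(** The cut has the parity of the total demand and the distance that of the balance, so the gap in
    the degree condition is even. *)
Lemma degree_parity G X A : valid G X -> A \subset verts G ->
  (2%:Z %| degree G A - nrm (balance G A))%Z.
Proof.
move=> vG AV; have := residue_norm_parity k (balance G A).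
have := dem_parity vG AV; rewrite /degree /balance.
by move: (nrm _) => w; lia.
Qed.

End Configurations.

(** * Directing and deleting an edge *)

Section Deletion.
Variables (V E : finType) (k : nat).
Local Notation M := (modulus k).
Local Notation nrm := (residue_norm k).
Implicit Types (G : config V E) (A B X : {set V}) (o : E -> bool).

Definition joins G (e : E) (x y : V) : bool :=
  (src G e == x) && (tgt G e == y) || (src G e == y) && (tgt G e == x).

Lemma crosses_joins G e x y A :
  joins G e x y -> crosses (src G e) (tgt G e) A = crosses x y A.
Proof. by case/orP=> /andP[/eqP-> /eqP->] //; rewrite /crosses addbC. Qed.

(* [e] is directed from [x] to [y] and removed, after which the numbers of arcs
   joining z0 to [x] and [y] are changed by the given amounts. *)
Definition delete_edge G e (x y : V) (px py qx qy : int) : config V E :=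
  Config (src G) (tgt G) (verts G) (edges G :\ e)
    (fun v => dem G v + (-1) * (v == x)%:Z + 1 * (v == y)%:Z)
    (fun v => inz G v + px * (v == x)%:Z + py * (v == y)%:Z)
    (fun v => outz G v + qx * (v == x)%:Z + qy * (v == y)%:Z).

Lemma total_update (f : V -> int) (a b : int) x y A :
  total (fun v => f v + a * (v == x)%:Z + b * (v == y)%:Z) A =
  total f A + a * (x \in A)%:Z + b * (y \in A)%:Z.
Proof. by rewrite !total_add !total_indicator. Qed.

(** The demands were changed by exactly what [e] contributes when directed from [x] to [y]; the arcs
    at z0 do not enter the definition of [orientable]. *)
Lemma delete_edge_orientable G e x y px py qx qy :
  e \in edges G -> joins G e x y ->
  orientable k (delete_edge G e x y px py qx qy) -> orientable k G.
Proof.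
move=> eF exy [o ho].
exists (fun d => if d == e then src G e == x else o d) => v vG.
have := ho v vG; rewrite /net /= (big_setD1 e eF) /= eqxx.
under [in X in _ -> X]eq_bigr => d.
  by rewrite !inE => /andP[/negPf-> _]; over.
set s := \sum_(d in _) _; move: s => s.
suff -> : direction (src G e == x) *
    ((src G e == v)%:Z - (tgt G e == v)%:Z) = (v == x)%:Z - (v == y)%:Z.
  by congr (is_true (_ %| _)%Z); lia.
case/orP: exy => /andP[/eqP-> /eqP->]; first by rewrite eqxx !(eq_sym v) mul1r.
rewrite !(eq_sym v); case: (eqVneq y x) => [->|_]; rewrite /direction; lia.
Qed.

Lemma cut_delete_edge G e x y px py qx qy A : e \in edges G -> joins G e x y ->
  cut (delete_edge G e x y px py qx qy) A = cut G A - crosses x y A.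
Proof.
move=> eF exy; rewrite /cut /= (big_setD1 e eF) /= (crosses_joins _ exy).
by rewrite addrAC subrr add0r.
Qed.

Lemma balance_delete_edge G e x y px py qx qy A :
  balance (delete_edge G e x y px py qx qy) A =
  balance G A + (qx - px - 1) * (x \in A)%:Z + (qy - py + 1) * (y \in A)%:Z.
Proof. rewrite /balance /= !total_update; case: (x \in A); case: (y \in A) => /=; rewrite ?mulr1 ?mulr0; lia.
Qed.

Lemma degree_delete_edge G e x y px py qx qy A :
  e \in edges G -> joins G e x y ->
  degree (delete_edge G e x y px py qx qy) A =
  degree G A - crosses x y A + (px + qx) * (x \in A)%:Z + (py + qy) * (y \in A)%:Z.
Proof.
move=> eF exy; rewrite /degree (cut_delete_edge _ _ _ _ _ eF exy) /= !total_update.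
by case: (x \in A); case: (y \in A) => /=; rewrite ?mulr1 ?mulr0; lia.
Qed.

(** The three bounds on absolute values say that the slack of 2 absorbs the change for a larger set
    containing only [x], only [y], or both. Other single vertices see no change, so only [x], [y]
    and z0 have to be checked by the user of the lemma. *)
Lemma delete_edge_valid G X e x y (px py qx qy : int) :
  let G' := delete_edge G e x y px py qx qy in
  valid k G X -> slack k G -> e \in edges G -> joins G e x y -> x != y ->
  0 <= inz G x + px -> 0 <= inz G y + py ->
  0 <= outz G x + qx -> 0 <= outz G y + qy ->
  `|qx - px - 1| <= 1 + (px + qx) -> `|qy - py + 1| <= 1 + (py + qy) ->
  `|qx - px + qy - py| <= 2 + (px + qx) + (py + qy) ->
  (forall v, v \in [set x; y] -> X != [set v] ->
    (4 * k)%:Z + nrm (balance G' [set v]) <= degree G' [set v]) ->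
  total (inz G') (verts G) + total (outz G') (verts G) <=
    (4 * k)%:Z + nrm (total (inz G') (verts G) - total (outz G') (verts G)) ->
  (M %| balance G' X)%Z ->
  valid k G' X.
Proof.
move=> G' vG sG eF exy xy px0 py0 qx0 qy0 hx hy hxy h1 hz hX.
have [xG yG] : x \in verts G /\ y \in verts G.
  have := src_verts vG eF; have := tgt_verts vG eF.
  by case/orP: exy => /andP[/eqP-> /eqP->].
have nyx : (y == x) = false by rewrite eq_sym; apply: negPf.
split => //=.
- by move=> d /setD1P[_ /(src_verts vG)].
- by move=> d /setD1P[_ /(tgt_verts vG)].
- move=> v; have := inz_ge0 vG v.
  by case: (eqVneq v x) => [->|_]; case: (eqVneq _ y) => [?|_]; subst; rewrite ?eqxx in xy *; lia.
- move=> v; have := outz_ge0 vG v.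
  by case: (eqVneq v x) => [->|_]; case: (eqVneq _ y) => [?|_]; subst; rewrite ?eqxx in xy *; lia.
- rewrite total_update xG yG; have := dem_verts vG.
  by congr (is_true (_ %| _)%Z); lia.
- move=> A AG; have := dem_parity vG AG.
  rewrite (cut_delete_edge _ _ _ _ _ eF exy) /= total_update /crosses.
  by case: (x \in A); case: (y \in A) => /=; rewrite ?mulr1 ?mulr0; lia.
- move=> A AG A0 AX; case: (ltnP 1 #|A|) => A1.
    have := sG A AG A1; rewrite /G' (degree_delete_edge _ _ _ _ _ eF exy).
    rewrite balance_delete_edge -addrA.
    have := residue_norm_shift k (balance G A)
      ((qx - px - 1) * (x \in A)%:Z + (qy - py + 1) * (y \in A)%:Z).
    by move: (nrm _) (nrm _); rewrite /crosses; case: (x \in A); case: (y \in A) => /=; rewrite ?mulr1 ?mulr0; lia.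
  have /cards1P[v Av] : #|A| == 1%N by rewrite eqn_leq A1 card_gt0.
  case: (boolP (v \in [set x; y])) => vxy.
    by rewrite Av; apply: h1 => //; rewrite -Av eq_sym.
  move: vxy; rewrite !inE negb_or => /andP[vx vy].
  have := degree_ge vG AG A0 AX; rewrite /G' (degree_delete_edge _ _ _ _ _ eF exy).
  rewrite balance_delete_edge /crosses Av !inE !(eq_sym _ v) (negPf vx) (negPf vy).
  by rewrite !mulr0 !addr0 /=; lia.
- exact: exception_card vG.
Qed.

End Deletion.

(** * Contracting a vertex set *)

Section Contraction.
Variables (V E : finType) (k : nat).
Local Notation M := (modulus k).
Local Notation nrm := (residue_norm k).
Implicit Types (G : config V E) (A B X : {set V}) (o : E -> bool) (g : V -> V).

Definition push_sum G g (f : V -> int) (v : V) : int :=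
  \sum_(u in verts G | g u == v) f u.

(** The edge set is kept: edges inside a fibre of [g] become loops, which contribute nothing to cuts
    or to [net]. *)
Definition quotient G g : config V E :=
  Config (fun e => g (src G e)) (fun e => g (tgt G e)) (g @: verts G) (edges G)
    (push_sum G g (dem G)) (push_sum G g (inz G)) (push_sum G g (outz G)).

Definition pull G g B : {set V} := [set u in verts G | g u \in B].

Lemma total_push_sum G g f B : total (push_sum G g f) B = total f (pull G g B).
Proof.
rewrite /total [RHS](partition_big g [in B]) /=; last by move=> u; rewrite inE => /andP[].
apply: eq_bigr => v vB; apply: eq_bigl => u; rewrite inE -andbA.
by case: (eqVneq (g u) v) => [->|_]; rewrite ?vB ?andbF.
Qed.

Lemma pull_verts G g : pull G g (g @: verts G) = verts G.
Proof.
by apply/setP=> v; rewrite inE; case: (boolP (v \in _)) => //= vG; apply: imset_f.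
Qed.

Lemma pull_proper G g B : B \proper g @: verts G -> pull G g B \proper verts G.
Proof.
case/properP=> BG [w /imsetP[u uG ->] uB]; apply/properP; split.
  by apply/subsetP=> v; rewrite inE => /andP[].
by exists u; rewrite // inE uG.
Qed.

Lemma pull_eq0 G g B : B \subset g @: verts G -> pull G g B = set0 -> B = set0.
Proof.
move=> BG /setP p0; apply/eqP; rewrite -subset0; apply/subsetP=> w wB.
have /imsetP[u uG wu] := subsetP BG w wB.
by have := p0 u; rewrite !inE uG -wu wB.
Qed.

Section QuotientOfValid.
Variables (G : config V E) (X : {set V}) (g : V -> V).
Hypothesis vG : valid k G X.

Lemma cut_quotient B : cut (quotient G g) B = cut G (pull G g B).
Proof.
apply: eq_bigr => e eF; rewrite /crosses !inE /=.
by rewrite (src_verts vG eF) (tgt_verts vG eF).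
Qed.

Lemma balance_quotient B : balance (quotient G g) B = balance G (pull G g B).
Proof. by rewrite /balance /= !total_push_sum. Qed.

Lemma degree_quotient B : degree (quotient G g) B = degree G (pull G g B).
Proof. by rewrite /degree /= !total_push_sum cut_quotient. Qed.

Lemma net_quotient o v : net (quotient G g) o v = total (net G o) (pull G g [set v]).
Proof.
rewrite total_net; apply: eq_bigr => e eF; rewrite !inE /=.
by rewrite (src_verts vG eF) (tgt_verts vG eF).
Qed.

(** Each condition on [B] is the condition on its preimage in [G]. The first hypothesis ensures that
    this preimage is never the waived set [X], unless [B] is itself waived. *)
Lemma quotient_valid X' :
  (forall B, B \subset g @: verts G -> B != X' -> pull G g B != X) ->
  (#|X'| <= 1)%N -> (M %| balance G (pull G g X'))%Z ->
  valid k (quotient G g) X'.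
Proof.
move=> hX cX bX; split=> //=.
- by move=> e eF; apply/imset_f/(src_verts vG).
- by move=> e eF; apply/imset_f/(tgt_verts vG).
- by move=> v; apply: sumr_ge0 => u _; apply: inz_ge0 vG u.
- by move=> v; apply: sumr_ge0 => u _; apply: outz_ge0 vG u.
- by rewrite total_push_sum pull_verts; apply: dem_verts vG.
- move=> B BG; rewrite total_push_sum cut_quotient; apply: dem_parity vG _ _.
  by apply/subsetP=> v; rewrite inE => /andP[].
- by rewrite !total_push_sum pull_verts; apply: z0_degree vG.
- move=> B BG B0 BX; rewrite balance_quotient degree_quotient.
  apply: degree_ge vG _ _ _ _; first exact: pull_proper.
    by apply: contraNneq B0 => /(pull_eq0 (proper_sub BG))->.
  exact: hX (proper_sub BG) BX.
- by rewrite balance_quotient.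
Qed.

End QuotientOfValid.

Definition contract G A (a : V) : config V E :=
  quotient G (fun v => if v \in A then a else v).

(** Preimages lie in [verts G] and contain all of [A] or nothing of it. So if [X] leaves [verts G]
    or is a vertex of [A], it is no preimage and the exception disappears; if [X] misses [A], it
    survives unchanged. *)
Lemma contract_valid G X A a : valid k G X -> A \subset verts G ->
  (1 < #|A|)%N -> a \in A -> exists X', valid k (contract G A a) X'.
Proof.
move=> vG AG A1 aA; set g := fun v => if v \in A then a else v.
have balance0 : (M %| balance G set0)%Z by rewrite /balance !total0.
case: (boolP (X \subset verts G)) => XG; last first.
  exists set0; apply: (quotient_valid vG); rewrite ?cards0 //.
    move=> B _ _; apply: contraNneq XG => <-.
    by apply/subsetP=> v; rewrite inE => /andP[].
  suff -> : pull G g set0 = set0 by [].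
  by apply/setP=> v; rewrite !inE andbF.
case: (set_0Vmem (X :&: A)) => [XA|[v]]; last first.
  case/setIP=> vX vA; have Xv : X = [set v].
    apply/eqP; rewrite eq_sym eqEcard sub1set vX cards1.
    exact: exception_card vG.
  have [w wA wv] : exists2 w, w \in A & w != v.
    have : A :\ v != set0 by rewrite -card_gt0; move: A1; rewrite (cardsD1 v A) vA.
    by case/set0Pn=> w /setD1P[]; exists w.
  exists set0; apply: (quotient_valid vG); rewrite ?cards0 //.
    move=> B _ _; apply: contraNneq wv => BX; rewrite -in_set1 -Xv -BX.
    move: vX; rewrite -BX !inE /g vA wA => /andP[_ ->].
    by rewrite (subsetP AG).
  suff -> : pull G g set0 = set0 by [].
  by apply/setP=> u; rewrite !inE andbF.
have outA u : u \in X -> u \notin A.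
  move=> uX; apply/negP=> uA; have : u \in X :&: A by rewrite inE uX.
  by rewrite XA inE.
exists X; apply: (quotient_valid vG) => //.
- move=> B BG; apply: contraNneq => BX; apply/eqP/setP=> w.
  apply/idP/idP => wX.
    have /imsetP[u uG wu] := subsetP BG w wX.
    have uX : u \in X by rewrite -BX inE uG -wu.
    by rewrite wu (negPf (outA _ uX)).
  have := wX; rewrite -{1}BX inE => /andP[_]; by rewrite /g (negPf (outA _ wX)).
- exact: exception_card vG.
suff -> : pull G g X = X by apply: exception_balance vG.
apply/setP=> u; rewrite inE /g; case: (boolP (u \in A)) => uA.
  have /negPf-> : u \notin X by apply: contraL uA => /outA.
  by apply/negbTE; rewrite negb_and; apply/orP; right; apply: contraL aA => /outA.
by case: (boolP (u \in X)) => uX; rewrite ?andbF ?andbT //; apply: (subsetP XG).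
Qed.

Lemma contract_smaller G A a : A \subset verts G -> (1 < #|A|)%N -> a \in A ->
  (#|verts (contract G A a)| < #|verts G|)%N.
Proof.
move=> AG A1 aA; have [w wA wa] : exists2 w, w \in A & w != a.
  have : A :\ a != set0 by rewrite -card_gt0; move: A1; rewrite (cardsD1 a A) aA.
  by case/set0Pn=> w /setD1P[]; exists w.
rewrite [X in (_ < X)%N](cardsD1 w) (subsetP AG w wA) ltnS; apply: subset_leq_card.
apply/subsetP=> _ /imsetP[u uG ->]; rewrite !inE; case: ifP => uA.
  by rewrite eq_sym wa (subsetP AG).
by rewrite uG andbT; apply: contraFneq uA => ->.
Qed.

(** An orientation of the contraction, read on the same edges of [G], is correct outside [A], but on
    [A] only in total: the edges inside [A] are loops there and remain undetermined. *)
Lemma contract_orientable G X A a : valid k G X -> A \subset verts G -> a \in A ->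
  orientable k (contract G A a) ->
  exists o, (M %| total (net G o) A - total (dem G) A)%Z /\
    forall v, v \in verts G -> v \notin A -> (M %| net G o v - dem G v)%Z.
Proof.
move=> vG AG aA [o ho]; set g := fun v => if v \in A then a else v.
have key v : v \in verts G -> (M %| total (net G o) (pull G g [set g v]) -
    total (dem G) (pull G g [set g v]))%Z.
  move=> uG; have := ho _ (imset_f g uG).
  by rewrite (net_quotient _ vG) -[dem _ _]total1 total_push_sum.
exists o; split.
  have := key a (subsetP AG a aA); rewrite {2 4}/g aA.
  suff -> : pull G g [set a] = A by [].
  apply/setP=> u; rewrite !inE /g; case: (boolP (u \in A)) => uA.
    by rewrite eqxx (subsetP AG).
  by case: eqP uA aA => [->|]; rewrite ?andbF // => /negPf->.
move=> v vV vA; have := key v vV; rewrite {2 4}/g (negPf vA).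
suff -> : pull G g [set v] = [set v] by rewrite !total1.
apply/setP=> u; rewrite !inE /g; case: (boolP (u \in A)) => uA.
  have -> : (a == v) = false by apply: contraNF vA => /eqP<-.
  by rewrite andbF; apply/esym/negbTE; apply: contraTneq uA => ->.
by case: eqP => [->|]; rewrite ?andbF ?vV.
Qed.

End Contraction.

(** * Orienting the inside of a tight set *)

Section Restriction.
Variables (V E : finType) (k : nat).
Local Notation M := (modulus k).
Local Notation nrm := (residue_norm k).
Implicit Types (G : config V E) (A B X : {set V}) (o : E -> bool).

Definition head_of G o (e : E) : V := if o e then tgt G e else src G e.
Definition tail_of G o (e : E) : V := if o e then src G e else tgt G e.

Definition inner_edges G A : {set E} :=
  [set e in edges G | (src G e \in A) && (tgt G e \in A)].

Definition end_count (D : {set E}) (h : E -> V) (v : V) : int :=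
  \sum_(e in D) (h e == v)%:Z.

(* The part of [G] on [A], once the edges leaving [A] are directed by [o] and
   their outer ends are moved to z0. *)
Definition restrict G A o : config V E :=
  let D := edges G :\: inner_edges G A in
  let I := end_count D (head_of G o) in let O := end_count D (tail_of G o) in
  Config (src G) (tgt G) A (inner_edges G A)
    (fun v => dem G v + I v - O v) (fun v => inz G v + I v)
    (fun v => outz G v + O v).

Lemma total_end_count (D : {set E}) (h : E -> V) B :
  total (end_count D h) B = \sum_(e in D) (h e \in B)%:Z.
Proof.
rewrite /total /end_count exchange_big /=; apply: eq_bigr => e _.
have := total_indicator 1 (h e) B; rewrite mul1r => <-.
by apply: eq_bigr => v _; rewrite mul1r eq_sym.
Qed.

Lemma total_sub (f g : V -> int) B :
  total (fun v => f v - g v) B = total f B - total g B.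
Proof. by rewrite /total big_split sumrN. Qed.

Lemma direction_ends G o e (P : V -> bool) :
  direction (o e) * ((P (src G e))%:Z - (P (tgt G e))%:Z) =
  (P (tail_of G o e))%:Z - (P (head_of G o e))%:Z.
Proof. by rewrite /tail_of /head_of /direction; case: (o e); lia. Qed.

Lemma inner_subset G A : inner_edges G A \subset edges G.
Proof. by apply/subsetP=> e; rewrite inE => /andP[]. Qed.

Section RestrictionOfValid.
Variables (G : config V E) (X A : {set V}) (o : E -> bool).
Hypothesis vG : valid k G X.
Hypothesis AG : A \proper verts G.
Let D := edges G :\: inner_edges G A.
Let G' := restrict G A o.

Lemma edges_split (f : E -> int) :
  \sum_(e in edges G) f e = \sum_(e in inner_edges G A) f e + \sum_(e in D) f e.
Proof.
rewrite (big_setID (inner_edges G A)) /=; congr (_ + _).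
by rewrite (setIidPr (inner_subset G A)).
Qed.

Lemma cut_restrict B : B \subset A -> cut G B = cut G' B +
  total (end_count D (head_of G o)) B + total (end_count D (tail_of G o)) B.
Proof.
move=> BA; rewrite /cut edges_split -addrA !total_end_count; congr (_ + _).
rewrite -big_split; apply: eq_bigr => e; rewrite !inE => /andP[+ eF].
rewrite eF /= /crosses /head_of /tail_of => nA.
(* An edge not inside [A] has at most one end in [B], so it crosses [B] exactly when its head or its
   tail lies there. *)
have : ~~ ((src G e \in B) && (tgt G e \in B)).
  by apply: contra nA => /andP[/(subsetP BA)-> /(subsetP BA)->].
by case: (o e); case: (src G e \in B); case: (tgt G e \in B).
Qed.

(** A directed edge enters the demand and the arcs at z0 with opposite signs, and cancels. *)
Lemma balance_restrict B : balance G' B = balance G B.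
Proof. by rewrite /balance /= total_sub !total_add; lia. Qed.

Lemma degree_restrict B : B \subset A -> degree G' B = degree G B.
Proof.
by move=> BA; rewrite /degree (cut_restrict BA) /= !total_add -/D; lia.
Qed.

Lemma cut_restrict_verts : cut G' A = 0.
Proof.
by apply: big1 => e /=; rewrite inE => /and3P[_ sA tA]; rewrite /crosses sA tA.
Qed.

Lemma net_restrict (o' : E -> bool) v :
  net G (fun e => if e \in inner_edges G A then o' e else o e) v =
  net G' o' v + end_count D (tail_of G o) v - end_count D (head_of G o) v.
Proof.
rewrite /net edges_split -addrA -sumrB; congr (_ + _).
  by apply: eq_bigr => e ->.
apply: eq_bigr => e /setDP[_ /negPf->].
exact: (direction_ends G o e (fun u => u == v)).
Qed.

Lemma total_dem_restrict :
  total (dem G') A = total (dem G) A - total (net G o) A.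
Proof.
rewrite /= total_sub total_add total_net edges_split big1 => [|e]; last first.
  by rewrite inE => /and3P[_ -> ->]; rewrite subrr mulr0.
rewrite add0r -addrA !total_end_count -sumrB -sumrN; congr (_ + _).
apply: eq_bigr => e _; rewrite (direction_ends G o e (fun u => u \in A)); lia.
Qed.

(* Tightness of [A] is what keeps the degree of z0 within its bound. *)
Lemma restrict_valid :
  degree G A <= (4 * k)%:Z + nrm (balance G A) ->
  (M %| total (net G o) A - total (dem G) A)%Z ->
  valid k G' (if X \subset A then X else set0).
Proof.
move=> tA oA.
have dA : (M %| total (dem G') A)%Z by rewrite total_dem_restrict -opprB rpredN.
have BAG B : B \subset A -> B \subset verts G.
  by move=> BA; apply: subset_trans BA (proper_sub AG).
split.
- by move=> e; rewrite inE => /and3P[].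
- by move=> e; rewrite inE => /and3P[].
- by move=> v /=; apply: addr_ge0; [apply: inz_ge0 vG v | apply: sumr_ge0].
- by move=> v /=; apply: addr_ge0; [apply: outz_ge0 vG v | apply: sumr_ge0].
- exact: dA.
- move=> B BA; have := dem_parity vG (BAG B BA).
  by rewrite (cut_restrict BA) /= total_sub total_add -/D; lia.
(* No remaining edge crosses [A], so z0 now has the degree that [A] has in [G], and its balance is
   opposite to that of [A] modulo 4k + 2. *)
- have := degree_restrict (subxx A); have := cut_restrict_verts.
  have := balance_restrict A; rewrite /degree.
  have -> : nrm (total (inz G') A - total (outz G') A) = nrm (balance G' A).
    rewrite -residue_normN; apply: residue_norm_dvd; rewrite -rpredN.
    by move: dA; congr (is_true (_ %| _)%Z); rewrite /balance; lia.
  by move=> -> -> /=; move: tA; rewrite /degree; lia.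
- move=> B BA B0 BX; rewrite balance_restrict degree_restrict ?proper_sub //.
  apply: (degree_ge vG) => //; first exact: proper_sub_trans BA (proper_sub AG).
  by apply: contraNneq BX => <-; rewrite proper_sub.
- by case: ifP => _; rewrite ?cards0 // (exception_card vG).
- rewrite balance_restrict; case: ifP => _; first exact: exception_balance vG.
  by rewrite /balance !total0.
Qed.

End RestrictionOfValid.

(** The contraction has fewer vertices because [A] has at least two, the restriction because [A] is
    proper, so the induction hypothesis covers both. The two orientations are used on disjoint sets
    of edges. *)
Lemma tight_orientable G X A :
  (forall G' X', valid k G' X' ->
     (#|verts G'| + #|edges G'| < #|verts G| + #|edges G|)%N -> orientable k G') ->
  valid k G X -> A \proper verts G -> (1 < #|A|)%N ->
  degree G A <= (4 * k)%:Z + nrm (balance G A) -> orientable k G.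
Proof.
move=> IH vG AG A1 tA; have [a aA] : exists a, a \in A.
  by apply/set0Pn; rewrite -card_gt0 ltnW.
have sAG := proper_sub AG.
have [X' vc] := contract_valid vG sAG A1 aA.
have [|o [oA oC]] := contract_orientable vG sAG aA.
  by apply: IH vc _; rewrite ltn_add2r; apply: contract_smaller.
have [|o' ho'] := IH _ _ (restrict_valid vG AG tA oA).
  rewrite -addSn leq_add ?proper_card // subset_leq_card //.
  exact: inner_subset.
exists (fun e => if e \in inner_edges G A then o' e else o e) => v vV.
case: (boolP (v \in A)) => vA.
  rewrite (net_restrict G A); have := ho' v vA => /=.
  by congr (is_true (_ %| _)%Z); lia.
(* Reorienting the edges inside [A] does not affect a vertex outside [A]. *)
have := oC v vV vA; congr (is_true (_ %| _ - _)%Z); apply: eq_bigr => e eF.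
case: ifP => //; rewrite inE => /and3P[_ sA tgA].
have [sv tv] : (src G e == v) = false /\ (tgt G e == v) = false.
  by split; apply: contraNF vA => /eqP<-.
by rewrite sv tv !mulr0.
Qed.

(** Without a tight set every gap is positive and even, hence at least 2. *)
Lemma slack_or_orientable G X :
  (forall G' X', valid k G' X' ->
     (#|verts G'| + #|edges G'| < #|verts G| + #|edges G|)%N -> orientable k G') ->
  valid k G X -> slack k G \/ orientable k G.
Proof.
move=> IH vG.
case: (boolP [exists A : {set V}, [&& A \proper verts G, (1 < #|A|)%N &
    degree G A <= (4 * k)%:Z + nrm (balance G A)]]) => [/existsP[A]|/existsPn hA].
  by case/and3P=> AG A1 tA; right; apply: (tight_orientable IH vG AG A1 tA).
left=> A AG A1; have := hA A; rewrite AG A1 /= -ltNge.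
have := degree_parity vG (proper_sub AG); move: (nrm _) => w; lia.
Qed.

End Restriction.

(** * The exceptional vertex: lifting and balancing *)

Section Exceptional.
Variables (V E : finType) (k : nat).
Local Notation M := (modulus k).
Local Notation nrm := (residue_norm k).
Implicit Types (G : config V E) (A B X : {set V}) (o : E -> bool).

(** The Boolean [(src G e == x) == b] directs [e] from [x] to [y] if [b] holds and from [y] to [x]
    otherwise, however [e] is stored. *)
Lemma direction_joins G e x y b v : joins G e x y ->
  direction ((src G e == x) == b) * ((src G e == v)%:Z - (tgt G e == v)%:Z) =
  direction b * ((v == x)%:Z - (v == y)%:Z).
Proof.
case/orP=> /andP[/eqP-> /eqP->]; rewrite !(eq_sym v); first by rewrite eqxx; case: b.
case: (eqVneq y x) => [->|_]; first by rewrite subrr !mulr0.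
by rewrite /direction; case: b => /=; lia.
Qed.

Lemma joins_sym G e x y : joins G e x y = joins G e y x.
Proof. by rewrite /joins orbC. Qed.

(** The name [e1] is reused for the new edge from [u] to [w], so the type of edges stays the
    same. *)
Definition lift_edges G (e1 e2 : E) (u w : V) : config V E :=
  Config (fun e => if e == e1 then u else src G e)
    (fun e => if e == e1 then w else tgt G e) (verts G) (edges G :\ e2)
    (dem G) (inz G) (outz G).

Section Lift.
Variables (G : config V E) (e1 e2 : E) (v0 u w : V).
Hypothesis e1G : e1 \in edges G.
Hypothesis e2G : e2 \in edges G.
Hypothesis e12 : e1 != e2.
Hypothesis je1 : joins G e1 v0 u.
Hypothesis je2 : joins G e2 v0 w.

Let e1G' : e1 \in edges G :\ e2. Proof. by rewrite !inE e12. Qed.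

Lemma cut_lift_edges A : cut (lift_edges G e1 e2 u w) A =
  cut G A - crosses v0 u A - crosses v0 w A + crosses u w A.
Proof.
rewrite /cut /= (big_setD1 e1) //= eqxx [in RHS](big_setD1 e2) //=.
rewrite [in RHS](big_setD1 e1) //= (crosses_joins _ je1) (crosses_joins _ je2).
under eq_bigr => d; first by rewrite !inE => /andP[/negPf-> _]; over.
by move: (\sum_(_ in _) _) => s; lia.
Qed.

(** The new edge is replaced by the path through [v0] in the same direction, which contributes
    nothing at [v0]. *)
Lemma lift_edges_orientable :
  orientable k (lift_edges G e1 e2 u w) -> orientable k G.
Proof.
case=> o ho; pose o' e := if e == e1 then (src G e1 == u) == o e1
  else if e == e2 then (src G e2 == v0) == o e1 else o e.
exists o' => v vG; have := ho v vG.
congr (is_true (_ %| _ - _)%Z).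
rewrite /net /= (big_setD1 e1) //= eqxx [in RHS](big_setD1 e2) //=.
rewrite [in RHS](big_setD1 e1) //= {1 2}/o' !eqxx (eq_sym e2) (negPf e12).
have je1' : joins G e1 u v0 by rewrite joins_sym.
rewrite (direction_joins _ _ je1') (direction_joins _ _ je2).
under eq_bigr => d; first by rewrite !inE => /andP[/negPf-> _]; over.
under [in RHS]eq_bigr => d.
  by rewrite !inE /o' => /and3P[/negPf-> /negPf-> _]; over.
rewrite !(eq_sym v); move: (\sum_(_ in _) _) => s; rewrite /direction.
by case: (o e1); clear; lia.
Qed.

(** Balances are unchanged, and a degree drops, by 2, only for sets separating [v0] from both [u]
    and [w]. Larger sets have that slack, and the only such single vertex is [v0], which is
    exempt. *)
Lemma lift_edges_valid : valid k G [set v0] -> slack k G ->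
  u != v0 -> w != v0 -> u != w -> valid k (lift_edges G e1 e2 u w) [set v0].
Proof.
move=> vG sG uv wv uw.
have joins_verts e x : e \in edges G -> joins G e v0 x -> x \in verts G.
  move=> eG jx; have := src_verts vG eG; have := tgt_verts vG eG.
  by case/orP: jx => /andP[/eqP-> /eqP->].
have uG := joins_verts _ _ e1G je1; have wG := joins_verts _ _ e2G je2.
split; rewrite /balance /degree /=.
- by move=> e /setD1P[_ eG]; case: ifP => _ //; apply: src_verts vG _ eG.
- by move=> e /setD1P[_ eG]; case: ifP => _ //; apply: tgt_verts vG _ eG.
- exact: inz_ge0 vG.
- exact: outz_ge0 vG.
- exact: dem_verts vG.
- move=> A AG; have := dem_parity vG AG; rewrite cut_lift_edges /crosses.
  by case: (u \in A); case: (w \in A); case: (v0 \in A) => /=; clear; lia.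
- exact: z0_degree vG.
- move=> A AG A0 AX; rewrite cut_lift_edges; case: (ltnP 1 #|A|) => A1.
    have := sG A AG A1; rewrite /degree /balance /crosses; move: (nrm _) => z.
    by case: (u \in A); case: (w \in A); case: (v0 \in A) => /=; clear; lia.
  have /cards1P[v Av] : #|A| == 1%N by rewrite eqn_leq A1 card_gt0.
  have := degree_ge vG AG A0 AX; rewrite /degree /balance /crosses.
  have vv0 : v0 != v by apply: contraNneq AX => ->; rewrite Av.
  rewrite Av !inE (negPf vv0); move: (nrm _) => z.
  case: (eqVneq u v) uw => [<- /negPf|_ _]; first by rewrite eq_sym => -> /=; clear; lia.
  by case: (w == v) => /=; clear; lia.
- exact: exception_card vG.
- exact: exception_balance vG.
Qed.

End Lift.

Lemma half_subset (T : finType) (N : {set T}) : ~~ odd #|N| ->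
  exists H : {set T}, H \subset N /\ #|N| = (2 * #|H|)%N.
Proof.
move=> eN; exists [set x in take #|N|./2 (enum N)]; split.
  by apply/subsetP=> x; rewrite inE => /mem_take; rewrite mem_enum.
have -> : #|[set x in take #|N|./2 (enum N)]| = #|N|./2.
  rewrite cardsE (card_uniqP _) ?take_uniq ?enum_uniq // size_take -cardE.
  by case: ltnP => //; lia.
by rewrite mul2n; lia.
Qed.

Lemma sum_direction_half (T : finType) (N H : {set T}) :
  H \subset N -> #|N| = (2 * #|H|)%N -> \sum_(e in N) direction (e \in H) = 0.
Proof.
move=> HN cN; rewrite (big_setID H) /= (setIidPr HN).
rewrite (eq_bigr (fun=> 1)) => [|e ->] //.
rewrite [X in _ + X](eq_bigr (fun=> -1)) => [|e /setDP[_ /negPf->]] //.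
rewrite !sumr_const; have := cardsID H N; rewrite (setIidPr HN) cN.
by move: #|_| #|_| => a b; rewrite mulNrn; lia.
Qed.

Section OneNeighbour.
Variables (G : config V E) (v0 w : V).
Hypothesis vG : valid k G [set v0].
Hypothesis v0G : v0 \in verts G.
Hypothesis wG : w \in verts G.
Hypothesis wv : w != v0.
Hypothesis only_w : forall e x, e \in edges G -> joins G e v0 x -> x != v0 -> x = w.
Hypothesis iz0 : inz G v0 = 0.
Hypothesis oz0 : outz G v0 = 0.
Let N := [set e in edges G | joins G e v0 w].

Let not_joined e : e \in edges G :\: N -> (src G e == v0) = (tgt G e == v0).
Proof.
rewrite !inE => /andP[+ eG]; rewrite eG /= => nj.
apply/idP/idP => ev; apply: contraNT nj => xv.
  by rewrite -(@only_w e (tgt G e)) // /joins ev eqxx.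
by rewrite -(@only_w e (src G e)) // /joins ev eqxx orbT.
Qed.

Let joined_split (f : E -> int) :
  \sum_(e in edges G) f e = \sum_(e in N) f e + \sum_(e in edges G :\: N) f e.
Proof.
rewrite (big_setID N) /=; congr (_ + _).
by rewrite (setIidPr _) //; apply/subsetP=> e; rewrite inE => /andP[].
Qed.

Let dem_v0 : (M %| dem G v0)%Z.
Proof.
have := exception_balance vG; rewrite /balance !total1 iz0 oz0.
by rewrite addr0 subr0.
Qed.

(** Apart from loops, the edges at [v0] are those of [N], so their number has the parity of the
    demand there, a multiple of 4k + 2. *)
Let joined_even : ~~ odd #|N|.
Proof.
have := @dem_parity _ _ _ _ _ vG [set v0]; rewrite sub1set v0G => /(_ isT).
rewrite total1 /cut joined_split [X in _ - (_ + X)]big1 ?addr0 => [|e /not_joined]; last first.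
  by rewrite /crosses !inE => ->; rewrite addbb.
rewrite (eq_bigr (fun=> 1)) => [|e]; last first.
  rewrite inE => /andP[_ /crosses_joins->].
  by rewrite /crosses !inE eqxx (negPf wv).
rewrite sumr_const; case/dvdzP: dem_v0 => j ->; rewrite /modulus.
have -> : j * (4 * k + 2)%N = j * (2 * k + 1)%N * 2 by lia.
by move: (j * _) #|_| => a b; lia.
Qed.

(* [v0] is balanced by directing half of the edges between [v0] and [w] each way. *)
Lemma one_neighbour_orientable :
  orientable k (contract G [set v0; w] w) -> orientable k G.
Proof.
have AG : [set v0; w] \subset verts G by rewrite subUset !sub1set v0G wG.
case/(contract_orientable vG AG (set22 _ _)) => o [oA oC].
have [H [HN cN]] := half_subset joined_even.
pose o' e := if e \in N then (src G e == v0) == (e \in H) else o e.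
have oN v : net G o' v = (\sum_(e in N) direction (e \in H)) *
    ((v == v0)%:Z - (v == w)%:Z) + \sum_(e in edges G :\: N)
    direction (o e) * ((src G e == v)%:Z - (tgt G e == v)%:Z).
  rewrite /net joined_split big_distrl /=; congr (_ + _).
    apply: eq_bigr => e eN; rewrite /o' eN.
    by move: eN; rewrite [_ \in N]inE => /andP[_ /direction_joins->].
  by apply: eq_bigr => e /setDP[_ /negPf eN]; rewrite /o' eN.
have net_v0 : net G o' v0 = 0.
  rewrite oN (sum_direction_half HN cN) mul0r add0r big1 // => e /not_joined->.
  by rewrite subrr mulr0.
(* Edges between [v0] and [w] cancel in the total over both, so redirecting them preserves it; [w]
   is then correct because [v0] is. *)
have netA : total (net G o') [set v0; w] = total (net G o) [set v0; w].
  rewrite !total_net !joined_split; congr (_ + _).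
    apply: eq_bigr => e; rewrite inE => /andP[_].
    by case/orP=> /andP[/eqP-> /eqP->]; rewrite set21 set22 subrr !mulr0.
  by apply: eq_bigr => e /setDP[_ /negPf eN]; rewrite /o' eN.
have total2 f : total f [set v0; w] = f v0 + f w.
  by rewrite /total big_setU1 ?big_set1 // inE eq_sym.
exists o' => v vV; case: (eqVneq v v0) => [->|vv0].
  by rewrite net_v0 sub0r rpredN.
case: (eqVneq v w) => [->|vw].
  have := oA; rewrite -netA !total2 net_v0 => h.
  by have := rpredD h dem_v0; congr (is_true (_ %| _)%Z); clear; lia.
have := oC v vV; rewrite !inE negb_or vv0 vw => /(_ isT).
congr (is_true (_ %| _ - _)%Z).
rewrite oN (sum_direction_half HN cN) mul0r add0r /net joined_split.
rewrite big1 ?add0r // => e; rewrite inE => /andP[_].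
by case/orP=> /andP[/eqP-> /eqP->]; rewrite !(eq_sym _ v) (negPf vv0) (negPf vw) mulr0.
Qed.

End OneNeighbour.

(** No edge crosses the complement of [v0], and its balance is opposite to that of z0 modulo 4k + 2.
    Its lower degree bound therefore equals the upper bound at z0, which leaves no arc between z0
    and [v0]. *)
Lemma isolated_exception G v0 : valid k G [set v0] -> v0 \in verts G ->
  (1 < #|verts G|)%N ->
  (forall e x, e \in edges G -> joins G e v0 x -> x = v0) ->
  inz G v0 = 0 /\ outz G v0 = 0.
Proof.
move=> vG v0G V1 hloop; pose A := verts G :\ v0.
have v0V : [set v0] \subset verts G by rewrite sub1set.
have AG : A \proper verts G by rewrite properD1.
have A0 : A != set0 by rewrite -card_gt0; move: V1; rewrite (cardsD1 v0) v0G.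
have AX : A != [set v0] by apply/eqP=> /setP/(_ v0); rewrite !inE eqxx.
have := degree_ge vG AG A0 AX; have := z0_degree vG.
have := inz_ge0 vG v0; have := outz_ge0 vG v0; rewrite /degree.
have -> : cut G A = 0.
  apply: big1 => e eG; rewrite /crosses !inE.
  rewrite (src_verts vG eG) (tgt_verts vG eG) !andbT.
  case: (eqVneq (src G e) v0) => [es|ns].
    by rewrite (hloop e (tgt G e)) ?eqxx // /joins es !eqxx.
  case: (eqVneq (tgt G e) v0) => [et|//].
  by rewrite (hloop e (src G e)) ?eqxx // /joins et !eqxx orbT in ns.
have -> : nrm (balance G A) =
    nrm (total (inz G) (verts G) - total (outz G) (verts G)).
  rewrite -residue_normN; apply: residue_norm_dvd.
  have := rpredB (exception_balance vG) (dem_verts vG); rewrite /A /balance.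
  by rewrite !(total_setD _ v0V); congr (is_true (_ %| _)%Z); lia.
rewrite !(total_setD _ v0V) !total1 -/A; move: (nrm _) => z; lia.
Qed.

(** An arc between z0 and [v0] is lifted together with [e] to an arc between z0 and [w] in the same
    direction. All balances, and the degrees of z0 and [w], stay the same. *)
Lemma exception_in_orientable G v0 e w :
  (forall G' X', valid k G' X' ->
     (#|verts G'| + #|edges G'| < #|verts G| + #|edges G|)%N -> orientable k G') ->
  valid k G [set v0] -> slack k G -> e \in edges G -> joins G e v0 w -> w != v0 ->
  0 < inz G v0 \/ 0 < outz G v0 -> orientable k G.
Proof.
move=> IH vG sG eG jv wv.
have [v0G wG] : v0 \in verts G /\ w \in verts G.
  have := src_verts vG eG; have := tgt_verts vG eG.
  by case/orP: jv => /andP[/eqP-> /eqP->].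
have smaller x y px py qx qy : (#|verts (delete_edge G e x y px py qx qy)| +
    #|edges (delete_edge G e x y px py qx qy)| < #|verts G| + #|edges G|)%N.
  by rewrite /= ltn_add2l [X in (_ < X)%N](cardsD1 e) eG.
have iw := inz_ge0 vG w; have ow := outz_ge0 vG w.
have i0 := inz_ge0 vG v0; have o0 := outz_ge0 vG v0.
have single v : v \in [set v0; w] -> [set v0] != [set v] -> v = w.
  by rewrite !inE => /orP[/eqP->|/eqP->] //; rewrite eqxx.
have w1 : [set w] \proper verts G.
  by apply/properP; split; [rewrite sub1set | exists v0; rewrite // inE eq_sym].
have w0 : [set w] != set0 by apply/set0Pn; exists w; rewrite inE.
have wX : [set w] != [set v0] by rewrite (inj_eq set1_inj).
have dw := degree_ge vG w1 w0 wX; have bX := exception_balance vG.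
have zG := z0_degree vG.
have nwv : (v0 == w) = false by rewrite eq_sym (negPf wv).
case=> pos.
  apply: (delete_edge_orientable eG jv (px := -1) (py := 1) (qx := 0) (qy := 0)).
  apply: (IH _ [set v0]) (smaller _ _ _ _ _ _).
  apply: delete_edge_valid => //; try by clear - pos iw ow o0; lia.
  - by rewrite eq_sym.
  - move=> v hv hX; rewrite (single v hv hX) degree_delete_edge //.
    rewrite balance_delete_edge /crosses !inE eqxx nwv mulr0 !addr0.
    by move: dw; rewrite mulr1 /=; clear; lia.
  - by rewrite /= !total_update v0G wG; move: zG; rewrite ?mulr1 ?mul0r ?addr0 subrK.
  - by rewrite balance_delete_edge !inE eqxx (negPf wv) mulr0 /= mul0r !addr0.
rewrite joins_sym in jv.
apply: (delete_edge_orientable eG jv (px := 0) (py := 0) (qx := 1) (qy := -1)).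
apply: (IH _ [set v0]) (smaller _ _ _ _ _ _).
apply: delete_edge_valid => //; try by clear - pos iw ow i0; lia.
- move=> v; rewrite setUC => hv hX; rewrite (single v hv hX) degree_delete_edge //.
  rewrite balance_delete_edge /crosses !inE eqxx nwv mulr0 !addr0.
  by move: dw; rewrite mulr1 /=; clear; lia.
- by rewrite /= !total_update v0G wG; move: zG; rewrite ?mulr1 ?mul0r ?addr0 addrK.
- by rewrite balance_delete_edge !inE eqxx (negPf wv) mulr0 /= mul0r !addr0.
Qed.

(** If [v0] has two neighbours, two edges are lifted. If it has one, arcs at z0 are lifted first,
    and once there are none [v0] is contracted into that neighbour. *)
Lemma exceptional_orientable G v0 :
  (forall G' X', valid k G' X' ->
     (#|verts G'| + #|edges G'| < #|verts G| + #|edges G|)%N -> orientable k G') ->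
  valid k G [set v0] -> slack k G -> v0 \in verts G -> (1 < #|verts G|)%N ->
  orientable k G.
Proof.
move=> IH vG sG v0G V1.
have contract_case w : w \in verts G -> w != v0 ->
    (forall e x, e \in edges G -> joins G e v0 x -> x != v0 -> x = w) ->
    inz G v0 = 0 -> outz G v0 = 0 -> orientable k G.
  move=> wG wv only iz oz; apply: (one_neighbour_orientable vG v0G wG wv only iz oz).
  have AG : [set v0; w] \subset verts G by rewrite subUset !sub1set v0G wG.
  have A1 : (1 < #|[set v0; w]|)%N by rewrite cards2 eq_sym wv.
  have [X' vc] := contract_valid vG AG A1 (set22 _ _).
  by apply: IH vc _; rewrite ltn_add2r contract_smaller ?set22.
case: (boolP [exists e in edges G, exists w, (w != v0) && joins G e v0 w]); last first.
  move=> /exists_inPn none.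
  have loops e x : e \in edges G -> joins G e v0 x -> x = v0.
    move=> eG jx; have /existsPn/(_ x) := none e eG.
    by rewrite jx andbT negbK => /eqP.
  have [iz oz] := isolated_exception vG v0G V1 loops.
  (* When only loops remain at [v0], any other vertex can serve as its one neighbour. *)
  have /set0Pn[w /setD1P[wv wG]] : verts G :\ v0 != set0.
    by rewrite -card_gt0; move: V1; rewrite (cardsD1 v0) v0G.
  by apply: (contract_case w) => // e x eG /(loops e x eG)->; rewrite eqxx.
case/exists_inP=> e eG /existsP[w /andP[wv jw]].
have wG : w \in verts G.
  have := src_verts vG eG; have := tgt_verts vG eG.
  by case/orP: jw => /andP[/eqP-> /eqP->].
case: (boolP [exists d in edges G, exists u, [&& u != v0, u != w & joins G d v0 u]]).
  case/exists_inP=> d dG /existsP[u /and3P[uv uw ju]].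
  have de : d != e.
    apply: contraNneq uw => de; move: ju jw; rewrite de /joins => ju jw.
    case/orP: ju => /andP[/eqP es /eqP et]; rewrite es et in jw.
      by move: jw; rewrite eqxx (negPf uv) andbF orbF.
    by move: jw; rewrite eqxx (negPf uv) /= andbT.
  apply: (lift_edges_orientable dG eG de ju jw).
  apply: (IH _ [set v0]); first exact: lift_edges_valid.
  by rewrite /= ltn_add2l [X in (_ < X)%N](cardsD1 e) eG.
move=> /exists_inPn none.
have only d x : d \in edges G -> joins G d v0 x -> x != v0 -> x = w.
  move=> dG jx xv; have /existsPn/(_ x) := none d dG.
  by rewrite jx xv /= andbT negbK => /eqP.
have := inz_ge0 vG v0; rewrite le_eqVlt => /orP[/eqP iz|iz]; last first.
  by apply: (exception_in_orientable IH vG sG eG jw wv); left.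
have := outz_ge0 vG v0; rewrite le_eqVlt => /orP[/eqP oz|oz]; last first.
  by apply: (exception_in_orientable IH vG sG eG jw wv); right.
exact: (contract_case w).
Qed.

End Exceptional.

(** * No vertex of balance zero *)

Section Unexceptional.
Variables (V E : finType) (k : nat).
Local Notation M := (modulus k).
Local Notation nrm := (residue_norm k).
Implicit Types (G : config V E) (A B X : {set V}) (o : E -> bool).

Definition reverse G : config V E :=
  Config (src G) (tgt G) (verts G) (edges G) (fun v => - dem G v) (outz G) (inz G).

Lemma totalN (f : V -> int) A : total (fun v => - f v) A = - total f A.
Proof. by rewrite /total sumrN. Qed.

Lemma balance_reverse G A : balance (reverse G) A = - balance G A.
Proof. by rewrite /balance /= totalN; lia. Qed.

Lemma degree_reverse G A : degree (reverse G) A = degree G A.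
Proof. by rewrite /degree /= addrAC. Qed.

Lemma reverse_orientable G : orientable k (reverse G) -> orientable k G.
Proof.
case=> o ho; exists (fun e => ~~ o e) => v vG; have := ho v vG.
rewrite -rpredN; congr (is_true (_ %| _)%Z).
rewrite opprD [- dem _ _]opprK; congr (_ - _); rewrite /net -sumrN.
apply: eq_bigr => e _ /=.
by rewrite -mulNr; congr (_ * _); case: (o e); rewrite /direction /= ?opprK.
Qed.

Lemma reverse_valid G X : valid k G X -> valid k (reverse G) X.
Proof.
move=> vG; split=> /=.
- exact: src_verts vG.
- exact: tgt_verts vG.
- exact: outz_ge0 vG.
- exact: inz_ge0 vG.
- by rewrite totalN rpredN; apply: dem_verts vG.
- move=> A AG; have := dem_parity vG AG; rewrite totalN.
  have -> : cut (reverse G) A = cut G A by [].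
  by clear; lia.
- by rewrite addrC -opprB residue_normN; apply: z0_degree vG.
- move=> A AG A0 AX; rewrite degree_reverse balance_reverse residue_normN.
  exact: degree_ge vG _ AG A0 AX.
- exact: exception_card vG.
- by rewrite balance_reverse rpredN; apply: exception_balance vG.
Qed.

Lemma reverse_slack G : slack k G -> slack k (reverse G).
Proof.
by move=> sG A AG A1; rewrite degree_reverse balance_reverse residue_normN; apply: sG.
Qed.

(** If the cut were empty, the degrees of [A] and its complement would add up to that of z0. Adding
    their lower bounds gives at least 8k plus two distances, while z0 allows at most 4k plus the
    distance of the sum. *)
Lemma crossing_edge G A : (0 < k)%N -> valid k G set0 -> A \proper verts G ->
  A != set0 -> exists e x y, [/\ e \in edges G, joins G e x y, x \in A & y \notin A].
Proof.
move=> k0 vG AG A0; pose B := verts G :\: A; have sAG := proper_sub AG.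
have B0 : B != set0.
  by have [_ [x xG xA]] := properP AG; apply/set0Pn; exists x; rewrite inE xA.
have BG : B \proper verts G.
  have [x xA] := set0Pn _ A0; apply/properP; split; first exact: subsetDl.
  by exists x; rewrite ?(subsetP sAG) // !inE xA.
have cutB : cut G B = cut G A.
  apply: eq_bigr => e eG; rewrite /crosses !inE.
  by rewrite (src_verts vG eG) (tgt_verts vG eG) !andbT addNb addbN negbK.
have : cut G A != 0.
  have := degree_ge vG AG A0 A0; have := degree_ge vG BG B0 B0.
  have := z0_degree vG; rewrite /degree cutB !(total_setD _ sAG) -/B.
  have <- : nrm (balance G (verts G)) =
      nrm (total (inz G) A + total (inz G) B - (total (outz G) A + total (outz G) B)).
    rewrite -residue_normN; apply: residue_norm_dvd; have := dem_verts vG.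
    rewrite -rpredN /balance !(total_setD _ sAG) -/B.
    by congr (is_true (_ %| _)%Z); clear; lia.
  have := residue_normD k (balance G A) (balance G B).
  rewrite -(balanceD _ sAG); move: (nrm _) (nrm _) (nrm _) (cut G A) => a b c d.
  by move: k0 => /[swap]; clear; lia.
rewrite /cut; case: (boolP [exists e in edges G,
    (src G e \in A) (+) (tgt G e \in A)]) => [/exists_inP[e eG ce] _|].
  exists e; case: (boolP (src G e \in A)) ce => /= sA tA.
    by exists (src G e), (tgt G e); split => //; rewrite /joins !eqxx.
  by exists (tgt G e), (src G e); split => //; rewrite /joins !eqxx orbT.
move=> /exists_inPn none; rewrite big1 ?eqxx // => e /none.
by rewrite /crosses => /negPf->.
Qed.

Lemma residue_norm_mod (z d : int) : nrm (z + d) = nrm ((z %% M)%Z + d).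
Proof.
apply: residue_norm_dvd; rewrite [X in X + d - _](divz_eq z M).
by apply/dvdzP; exists (z %/ M)%Z; move: (_ * M) (z %% M)%Z => a b; clear; lia.
Qed.

Lemma residue_norm_modz (z : int) : nrm z = nrm (z %% M)%Z.
Proof. by rewrite -{1}[z]addr0 residue_norm_mod addr0. Qed.

(** The degree of [x] changes by -1 + px + qx, and that of [y] likewise; the two conditions on [nrm]
    say that the distances rise by no more than this. *)
Lemma delete_edge_step G e x y (px py qx qy : int) :
  (forall G' X', valid k G' X' ->
     (#|verts G'| + #|edges G'| < #|verts G| + #|edges G|)%N -> orientable k G') ->
  valid k G set0 -> slack k G -> e \in edges G -> joins G e x y -> x != y ->
  let I := total (inz G) (verts G) in let O := total (outz G) (verts G) in
  0 <= px -> 0 <= py -> 0 <= qx -> 0 <= qy ->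
  `|qx - px - 1| <= 1 + (px + qx) -> `|qy - py + 1| <= 1 + (py + qy) ->
  `|qx - px + qy - py| <= 2 + (px + qx) + (py + qy) ->
  nrm (balance G [set x] + (qx - px - 1)) <= nrm (balance G [set x]) - 1 + (px + qx) ->
  nrm (balance G [set y] + (qy - py + 1)) <= nrm (balance G [set y]) - 1 + (py + qy) ->
  I + px + py + (O + qx + qy) <=
    (4 * k)%:Z + nrm (I + px + py - (O + qx + qy)) ->
  orientable k G.
Proof.
move=> IH vG sG eG jxy xy I O px0 py0 qx0 qy0 hx hy hxy nx ny hz.
have yx : (y == x) = false by rewrite eq_sym (negPf xy).
have [xG yG] : x \in verts G /\ y \in verts G.
  have := src_verts vG eG; have := tgt_verts vG eG.
  by case/orP: jxy => /andP[/eqP-> /eqP->].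
apply: (delete_edge_orientable eG jxy (px := px) (py := py) (qx := qx) (qy := qy)).
apply: (IH _ set0); last first.
  by rewrite /= ltn_add2l [X in (_ < X)%N](cardsD1 e) eG.
have single v : v \in verts G -> (4 * k)%:Z + nrm (balance G [set v]) <= degree G [set v].
  move=> vV; apply: degree_ge vG _ _ _ _.
  - rewrite properEcard sub1set vV cards1 (cardsD1 x) (cardsD1 y) xG !inE yx yG //.
  - by apply/set0Pn; exists v; rewrite inE.
  - by apply/set0Pn; exists v; rewrite inE.
apply: delete_edge_valid => //; rewrite ?addr_ge0 ?(inz_ge0 vG) ?(outz_ge0 vG) //.
- move=> v; rewrite !inE => /orP[/eqP->|/eqP->] _.
    have := single x xG; rewrite degree_delete_edge // balance_delete_edge.
    rewrite /crosses !inE eqxx yx /= mulr0 !mulr1 !addr0.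
    by move: nx; move: (nrm _) (nrm _) => a b; clear; lia.
  have := single y yG; rewrite degree_delete_edge // balance_delete_edge.
  rewrite /crosses !inE eqxx (negPf xy) /= mulr0 !mulr1 !addr0.
  by move: ny; move: (nrm _) (nrm _) => a b; clear; lia.
- by rewrite /= !total_update xG yG /= !mulr1.
- by rewrite /balance !total0.
Qed.

(** The demand is kept, so the orientations sought are the same while the balance of [x] falls by 1.
    Vertices and edges stay, so progress is measured by the degree of z0. *)
Definition remove_out G x : config V E :=
  Config (src G) (tgt G) (verts G) (edges G) (dem G) (inz G)
    (fun v => outz G v + (-1) * (v == x)%:Z).

Lemma remove_out_valid G x : valid k G set0 -> slack k G -> x \in verts G ->
  0 < outz G x ->
  nrm (balance G [set x] - 1) <= nrm (balance G [set x]) - 1 ->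
  valid k (remove_out G x) set0.
Proof.
move=> vG sG xG ox nx.
have eqb A : balance (remove_out G x) A = balance G A - (x \in A)%:Z.
  by rewrite /balance /= total_add total_indicator; clear; lia.
have eqd A : degree (remove_out G x) A = degree G A - (x \in A)%:Z.
  by rewrite /degree /= total_add total_indicator mulN1r !addrA.
split=> //=.
- exact: src_verts vG.
- exact: tgt_verts vG.
- exact: inz_ge0 vG.
- move=> v; have := outz_ge0 vG v.
  by case: (eqVneq v x) => [->|_]; move: ox; clear; lia.
- exact: dem_verts vG.
- exact: dem_parity vG.
- have := z0_degree vG; rewrite total_add total_indicator xG /=.
  have := residue_norm_shift k
    (total (inz G) (verts G) - (total (outz G) (verts G) - 1)) (-1).
  have -> : total (inz G) (verts G) - (total (outz G) (verts G) - 1) - 1 =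
    total (inz G) (verts G) - total (outz G) (verts G) by clear; lia.
  by rewrite mulr1; move: (nrm _) (nrm _) => a b; clear; lia.
- move=> A AG A0 _; rewrite eqb eqd; case: (ltnP 1 #|A|) => A1.
    have := sG A AG A1; have := residue_norm_shift k (balance G A) (- (x \in A)%:Z).
    by move: (nrm _) (nrm _) => a b; case: (x \in A) => /=; clear; lia.
  have /cards1P[v Av] : #|A| == 1%N by rewrite eqn_leq A1 card_gt0.
  have := degree_ge vG AG A0 A0; rewrite Av inE.
  case: (eqVneq x v) nx => [<-|_ _] /=; last by rewrite subr0; clear; lia.
  by move: (nrm _) (nrm _) => a b; clear; lia.
- by rewrite cards0.
- by rewrite /balance !total0.
Qed.

(** Here each distance is the residue itself and falls when the balance is lowered by 1. Arcs into
    z0 are thus dropped first; when none is left, an edge is directed, with new arcs at z0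
    compensating at one end. *)
Lemma low_residues_orientable G : (0 < k)%N ->
  (forall G' X', valid k G' X' ->
     (#|verts G'| + #|edges G'| < #|verts G| + #|edges G|)%N -> orientable k G') ->
  (forall G' X', valid k G' X' ->
     (#|verts G'| + #|edges G'| <= #|verts G| + #|edges G|)%N ->
     total (inz G') (verts G') + total (outz G') (verts G') <
     total (inz G) (verts G) + total (outz G) (verts G) -> orientable k G') ->
  valid k G set0 -> slack k G -> (1 < #|verts G|)%N ->
  (forall v, v \in verts G -> 1 <= (balance G [set v] %% M)%Z <= (2 * k)%:Z) ->
  orientable k G.
Proof.
move=> k0 IH IHz vG sG V1 low.
have nrm_low v (d : int) : v \in verts G ->
    0 <= (balance G [set v] %% M)%Z + d <= (2 * k + 1)%:Z ->
    nrm (balance G [set v] + d) = (balance G [set v] %% M)%Z + d.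
  by move=> vV h; rewrite residue_norm_mod residue_norm_small.
have nrm_eq v : v \in verts G -> nrm (balance G [set v]) = (balance G [set v] %% M)%Z.
  move=> vV; have := nrm_low v 0 vV; rewrite !addr0; apply.
  by move: (low v vV); clear; lia.
have nrm_pred v : v \in verts G ->
    nrm (balance G [set v] - 1) = nrm (balance G [set v]) - 1.
  by move=> vV; rewrite nrm_eq // nrm_low //; move: (low v vV); clear; lia.
have I0 := total_ge0 (verts G) (inz_ge0 vG).
case: (boolP [exists x in verts G, 0 < outz G x]) => [/exists_inP[x xG ox]|].
  have vR : valid k (remove_out G x) set0.
    by apply: remove_out_valid => //; rewrite nrm_pred.
  have [||o ho] := IHz _ _ vR; [by [] | | by exists o].
  by rewrite /= total_add total_indicator xG; clear; lia.
move=> /exists_inPn noout.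
have O0 : total (outz G) (verts G) = 0.
  apply: big1 => v vV; have := outz_ge0 vG v; have := noout v vV.
  by rewrite -leNgt; clear; lia.
have [x xG] : exists x, x \in verts G by apply/set0Pn; rewrite -card_gt0 ltnW.
have [e [x' [y [eG jxy]]]] := crossing_edge (A := [set x]) k0 vG
  ltac:(by rewrite properEcard sub1set xG cards1)
  ltac:(by apply/set0Pn; exists x; rewrite inE).
rewrite !inE => /eqP ex; subst x'; rewrite eq_sym => xy.
have yG : y \in verts G.
  have := src_verts vG eG; have := tgt_verts vG eG.
  by case/orP: jxy => /andP[/eqP-> /eqP->].
have zG := z0_degree vG; rewrite O0 addr0 in zG.
(* A total I of at least 4k + 2 has distance at most I - (4k + 2), and the bound at z0 would give I
   <= I - 2. *)
have Ile : total (inz G) (verts G) <= (4 * k + 1)%:Z.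
  have := residue_norm_max k (total (inz G) (verts G)).
  have := residue_norm_le k (total (inz G) (verts G)) 1; rewrite mul1r /modulus.
  by move: zG I0; clear; lia.
case: (lerP (total (inz G) (verts G)) (4 * k)%:Z) => Ik.
  (* The edge goes from [x] to [y], and a new arc from z0 preserves balance and degree of [y]. For I
     = 4k the bound at z0 holds with equality, as 4k + 1 has distance 1. *)
  apply: (delete_edge_step (px := 0) (py := 1) (qx := 0) (qy := 0)
    IH vG sG eG jxy xy) => //.
  - by rewrite !addr0 add0r nrm_pred.
  - by rewrite sub0r addNr !addr0 subrK.
  - rewrite O0 !addr0.
    have := residue_norm_ge0 k (total (inz G) (verts G) + 1).
    case: (ltrP (total (inz G) (verts G)) (4 * k)%:Z) => Ik'.
      by move: Ik'; clear; lia.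
    have -> : total (inz G) (verts G) = (4 * k)%:Z by apply/le_anti/andP.
    rewrite residue_norm_large; last by rewrite /modulus; move: k0; clear; lia.
    by rewrite /modulus; clear; lia.
have Ieq : total (inz G) (verts G) = (4 * k + 1)%:Z by move: Ile Ik; clear; lia.
(* For I = 4k + 1 another arc from z0 would bring its distance to 0 and break the bound, so the edge
   is directed from [y] to [x] and arcs into z0 are added instead. *)
rewrite joins_sym in jxy; rewrite eq_sym in xy.
(* With this many new arcs from [x] to z0, the balance of [x] becomes [2k + 2] and
   the degree bound at z0 an equality. *)
set t := (2 * k + 1)%:Z - (balance G [set x] %% M)%Z.
have lx := low x xG; have t0 : 0 <= t by rewrite /t; move: lx; clear; lia.
apply: (delete_edge_step (px := 0) (py := 0) (qx := 0) (qy := t)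
    IH vG sG eG jxy xy) => //.
- by move: t0; clear; lia.
- by move: t0; clear; lia.
- by rewrite !addr0 add0r nrm_pred.
- rewrite subr0 add0r (nrm_eq x xG) residue_norm_mod residue_norm_large.
    by rewrite /t /modulus; clear; lia.
  by rewrite /t /modulus; clear; lia.
- rewrite O0 Ieq !addr0 add0r residue_norm_large;
  by move: lx; rewrite /t; move: (_ %% M)%Z => w; rewrite /modulus; clear; lia.
Qed.

(** Directing [e] from [x] to [y] moves the residue of [x] down towards 0 and that of [y] up towards
    4k + 2, so both distances fall along with the degrees and z0 is untouched. *)
Lemma mid_crossing_orientable G e x y :
  (forall G' X', valid k G' X' ->
     (#|verts G'| + #|edges G'| < #|verts G| + #|edges G|)%N -> orientable k G') ->
  valid k G set0 -> slack k G -> e \in edges G -> joins G e x y -> x != y ->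
  1 <= (balance G [set x] %% M)%Z <= (2 * k + 1)%:Z ->
  (2 * k + 1)%:Z <= (balance G [set y] %% M)%Z -> orientable k G.
Proof.
move=> IH vG sG eG jxy xy rx ry.
have yM : (balance G [set y] %% M)%Z < M by apply: ltz_pmod; apply: modulus_gt0.
apply: (delete_edge_step (px := 0) (py := 0) (qx := 0) (qy := 0)
    IH vG sG eG jxy xy) => //.
- rewrite residue_norm_mod [nrm (balance G [set x])]residue_norm_modz !residue_norm_small //.
  + by clear; lia.
  + by move: rx; clear; lia.
  + by move: rx; clear; lia.
- rewrite residue_norm_mod [nrm (balance G [set y])]residue_norm_modz !residue_norm_large //.
  + by clear; lia.
  + by move: ry yM; clear; lia.
  + by move: ry yM; clear; lia.
- by rewrite !addr0; apply: z0_degree vG.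
Qed.

Lemma unexceptional_orientable G : (0 < k)%N ->
  (forall G' X', valid k G' X' ->
     (#|verts G'| + #|edges G'| < #|verts G| + #|edges G|)%N -> orientable k G') ->
  (forall G' X', valid k G' X' ->
     (#|verts G'| + #|edges G'| <= #|verts G| + #|edges G|)%N ->
     total (inz G') (verts G') + total (outz G') (verts G') <
     total (inz G) (verts G) + total (outz G) (verts G) -> orientable k G') ->
  valid k G set0 -> slack k G -> (1 < #|verts G|)%N ->
  (forall v, v \in verts G -> ~~ (M %| balance G [set v])%Z) ->
  orientable k G.
Proof.
move=> k0 IH IHz vG sG V1 nz; have M0 := modulus_gt0 k.
pose r v := (balance G [set v] %% M)%Z.
have r_bounds v : v \in verts G -> 1 <= r v < M.
  move=> vV; have /dvdz_mod0P := nz v vV; rewrite /r.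
  have := modz_ge0 (balance G [set v]) (lt0r_neq0 M0).
  have := ltz_pmod (balance G [set v]) M0.
  by move: (_ %% M)%Z => a; move: M => b; clear; lia.
pose A := [set v in verts G | r v <= (2 * k)%:Z].
have sAG : A \subset verts G by apply/subsetP=> v; rewrite inE => /andP[].
case: (eqVneq A (verts G)) => [AV|AV].
  apply: low_residues_orientable => // v vV.
  by have := r_bounds v vV; move: vV; rewrite -AV inE => /andP[_]; rewrite /r; clear; lia.
have AG : A \proper verts G by rewrite properEneq AV.
have vert e x y : e \in edges G -> joins G e x y -> y \in verts G.
  move=> eG jxy; have := src_verts vG eG; have := tgt_verts vG eG.
  by case/orP: jxy => /andP[/eqP-> /eqP->].
case: (eqVneq A set0) => [A0|A0]; last first.
  have [e [x [y [eG jxy xA yA]]]] := crossing_edge k0 vG AG A0.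
  have yG := vert e x y eG jxy.
  apply: (mid_crossing_orientable IH vG sG eG jxy).
  - by apply: contraNneq yA => <-.
  - have := r_bounds x (subsetP sAG x xA); move: xA; rewrite inE => /andP[_].
    by rewrite /r; clear; lia.
  - by move: yA; rewrite inE yG /= -ltNge /r; clear; lia.
have high v : v \in verts G -> (2 * k + 1)%:Z <= r v.
  move=> vV; have : v \notin A by rewrite A0 inE.
  by rewrite inE vV /= -ltNge; clear; lia.
(* The middle residue 2k + 1 moves closer to a multiple in either direction, so such a vertex can be
   the tail of an edge to any neighbour. *)
case: (boolP [exists x in verts G, r x == (2 * k + 1)%:Z]) => [/exists_inP[x xG /eqP rx]|].
  have [e [x' [y [eG jxy]]]] := crossing_edge (A := [set x]) k0 vG
    ltac:(by rewrite properEcard sub1set xG cards1)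
    ltac:(by apply/set0Pn; exists x; rewrite inE).
  rewrite !inE => /eqP ex; subst x'; rewrite eq_sym => xy.
  apply: (mid_crossing_orientable IH vG sG eG jxy xy).
    by rewrite -/(r x) rx; clear; lia.
  exact: high (vert e x y eG jxy).
(* All residues now exceed 2k + 1; reversal replaces r by 4k + 2 - r, which lies between 1 and
   2k. *)
move=> /exists_inPn nmid; apply: reverse_orientable.
apply: low_residues_orientable => //.
- move=> G' X' vG' lt lt'; apply: IHz vG' lt _.
  by rewrite [X in _ < X]addrC.
- exact: reverse_valid.
- exact: reverse_slack.
move=> v vV; rewrite balance_reverse.
have -> : (- balance G [set v] %% M)%Z = M - r v.
  rewrite -(modz_small (m := M - r v) (d := M)).
    rewrite -(modzMDl (1 + (balance G [set v] %/ M)%Z)); congr (_ %% _)%Z.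
    rewrite [X in _ - X](divz_eq (balance G [set v]) M) -/(r v) mulrDl mul1r.
    by move: (_ * M) => a; clear; lia.
  have := r_bounds v vV; move: (r v) => a; move: M => b; clear; lia.
have := high v vV; have := r_bounds v vV; have := nmid v vV; rewrite /modulus.
by move: (r v); clear; lia.
Qed.

End Unexceptional.

(** * The induction *)

Section ValidOrientable.
Variables (V E : finType) (k : nat).
Local Notation M := (modulus k).
Implicit Types (G : config V E) (A B X : {set V}).

(** If the waiver concerns no nonempty proper set of vertices, it can be moved to any vertex of
    balance 0. *)
Lemma change_exception G X X' : valid k G X ->
  (forall A, A \proper verts G -> A != set0 -> A != X) ->
  (#|X'| <= 1)%N -> (M %| balance G X')%Z -> valid k G X'.
Proof.
move=> vG hX cX bX; split=> //.
- exact: src_verts vG.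
- exact: tgt_verts vG.
- exact: inz_ge0 vG.
- exact: outz_ge0 vG.
- exact: dem_verts vG.
- exact: dem_parity vG.
- exact: z0_degree vG.
- by move=> A AG A0 _; apply: (degree_ge vG) => //; apply: hX.
Qed.

Lemma small_orientable G X : valid k G X -> (#|verts G| <= 1)%N -> orientable k G.
Proof.
move=> vG V1; exists (fun=> true) => v vV.
have Gv : verts G = [set v].
  by apply/eqP; rewrite eq_sym eqEcard sub1set vV cards1.
have := dem_verts vG; rewrite Gv total1 => dv.
rewrite /net big1 ?sub0r ?rpredN // => e eG.
have := src_verts vG eG; have := tgt_verts vG eG.
by rewrite Gv !inE => -> ->; rewrite subrr mulr0.
Qed.

(** The outer induction is on the number of vertices and edges, the inner one on the degree of z0,
    needed when an arc at z0 is dropped. *)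
Lemma valid_orientable G X : (0 < k)%N -> valid k G X -> orientable k G.
Proof.
move=> k0; have [n] := ubnP (#|verts G| + #|edges G|)%N.
elim: n G X => // n IHn G X.
have [m] := ubnP (absz (total (inz G) (verts G) + total (outz G) (verts G))).
elim: m G X => // m IHm G X; rewrite !ltnS => Dm Gn vG.
have IH G' X' : valid k G' X' ->
    (#|verts G'| + #|edges G'| < #|verts G| + #|edges G|)%N -> orientable k G'.
  by move=> vG' lt; apply: IHn vG'; apply: leq_trans lt Gn.
have IHz G' X' : valid k G' X' ->
    (#|verts G'| + #|edges G'| <= #|verts G| + #|edges G|)%N ->
    total (inz G') (verts G') + total (outz G') (verts G') <
    total (inz G) (verts G) + total (outz G) (verts G) -> orientable k G'.
  move=> vG' le lt; apply: (IHm G' X') => //; last by rewrite ltnS (leq_trans le).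
  apply: leq_trans Dm.
  have := total_ge0 (verts G') (inz_ge0 vG').
  have := total_ge0 (verts G') (outz_ge0 vG').
  by move: lt; clear; lia.
case: (leqP #|verts G| 1) => V1; first exact: small_orientable vG V1.
case: (slack_or_orientable IH vG) => // sG.
case: (boolP [exists v in verts G, X == [set v]]) => [/exists_inP[v vV /eqP Xv]|].
  by rewrite Xv in vG; apply: (exceptional_orientable IH vG).
move=> /exists_inPn noX.
have hX A : A \proper verts G -> A != set0 -> A != X.
  move=> AG A0; apply/eqP=> AX; have := exception_card vG; rewrite -AX => A1.
  have /cards1P[v Av] : #|A| == 1%N by rewrite eqn_leq A1 card_gt0.
  have := noX v; rewrite -AX Av eqxx => /(_ _)/negP; apply=> //.
  by apply: (subsetP (proper_sub AG)); rewrite Av inE.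
case: (boolP [exists v in verts G, (M %| balance G [set v])%Z]).
  case/exists_inP=> v vV bv; apply: (exceptional_orientable (v0 := v) IH) => //.
  by apply: (change_exception vG) => //; rewrite cards1.
move=> /exists_inPn nz; apply: (unexceptional_orientable k0 IH IHz) => //.
by apply: (change_exception vG); rewrite ?cards0 // /balance !total0.
Qed.

End ValidOrientable.

(** * From orientations to flows *)

Section FlowFromOrientation.
Variables (V E : finType) (k : nat) (tail head : E -> V).
Variable beta : V -> 'Z_(2 * k + 1).
Hypothesis k0 : (1 <= k)%N.
Local Notation n := (2 * k + 1)%N.

Lemma intr_Zp_dvd (z : int) : (n%:Z %| z)%Z -> z%:~R = 0 :> 'Z_n.
Proof.
case/dvdzP=> j ->; rewrite intrM; have -> : (n%:Z)%:~R = 0 :> 'Z_n.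
  by rewrite -pmulrn pchar_Zp //; lia.
by rewrite mulr0.
Qed.

(* Directing an arc along itself where the flow is 1 and backwards where it is 0
   turns a boundary [b] into a net outdegree of [2 b] minus the degree difference. *)
Definition boundary_config : config V E :=
  Config tail head setT setT
    (fun v => 2 * (beta v : nat)%:Z -
       (end_count setT tail v - end_count setT head v))
    (fun=> 0) (fun=> 0).

Lemma total_dem_boundary A : total (dem boundary_config) A =
  2 * total (fun v => (beta v : nat)%:Z) A -
  (\sum_(e in setT) (tail e \in A)%:Z - \sum_(e in setT) (head e \in A)%:Z).
Proof. by rewrite /= !total_sub !total_end_count /total -big_distrr. Qed.

(** With fewer than m edges crossing [A], deleting them would leave [A] closed under adjacency. *)
Lemma cut_ge_connectivity m (A : {set V}) : edge_connected tail head m ->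
  A \proper setT -> A != set0 -> m%:Z <= cut boundary_config A.
Proof.
move=> conn /properP[_ [y _ yA]] /set0Pn[x xA].
pose F := [set e | (tail e \in A) (+) (head e \in A)].
have -> : cut boundary_config A = (#|F|)%:Z.
  rewrite -sum1_card /cut /= (eq_bigl predT) => [|e]; last by rewrite inE.
  rewrite [RHS](raddf_sum Posz) [RHS]big_mkcond; apply: eq_bigr => e _.
  by rewrite /crosses inE; case: (_ (+) _).
rewrite lez_nat leqNgt; apply/negP => /conn/(_ x y) xy.
suff cl : closed (adj_minus tail head F) (mem A).
  by move: yA; rewrite -(closed_connect cl xy) xA.
move=> u v /existsP[e /andP[]]; rewrite inE addbC -negb_eqb negbK => /eqP ht.
by case/orP=> /andP[/eqP<- /eqP<-]; [exact: esym ht | exact: ht].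
Qed.

Lemma boundary_config_valid : is_boundary beta ->
  edge_connected tail head (6 * k) -> valid k boundary_config set0.
Proof.
move=> hbeta conn.
have total_zero (A : {set V}) : total (fun=> 0) A = 0 by rewrite /total big1.
have ends (A : {set V}) : (2%:Z %| \sum_(e in setT) (tail e \in A)%:Z -
    \sum_(e in setT) (head e \in A)%:Z + cut boundary_config A)%Z.
  rewrite /cut -sumrB -big_split; apply: rpred_sum => e _ /=; rewrite /crosses.
  by case: (tail e \in A); case: (head e \in A).
have par (A : {set V}) : (2%:Z %| total (dem boundary_config) A - cut boundary_config A)%Z.
  rewrite total_dem_boundary; have := ends A.
  by move: (total _ _) (cut _ _) (_ - _) => a b c; clear; lia.
split=> //=; rewrite ?total_zero ?cards0 //.
- have -> : total (dem boundary_config) setT =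
      2 * total (fun v => (beta v : nat)%:Z) setT.
    rewrite total_dem_boundary -sumrB big1 ?subr0 // => e _.
    by rewrite !inE subrr.
  (* Doubling a multiple of 2k + 1 gives a multiple of 4k + 2. *)
  suff /dvdzP[j ->] : (n%:Z %| total (fun v => (beta v : nat)%:Z) setT)%Z.
    by apply/dvdzP; exists j; rewrite /modulus; clear; lia.
  have -> : total (fun v => (beta v : nat)%:Z) setT = (\sum_v (beta v : nat))%:Z.
    by rewrite (raddf_sum Posz) /total; apply: eq_bigl => v; rewrite inE.
  rewrite dvdzE !absz_nat /dvdn -val_Zp_nat ?natr_sum; last by lia.
  under eq_bigr do rewrite natr_Zp.
  by rewrite hbeta.
- by rewrite addr0; apply: addr_ge0 => //; apply: residue_norm_ge0.
(* The cut is at least 6k and the distance at most 2k + 1. The missing 1 in the extreme case comes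
   from parity: the cut is then odd, so at least 6k + 1. *)
- move=> A AV A0 _; rewrite /degree /balance !total_zero !addr0.
  have := cut_ge_connectivity conn AV A0; have := par A.
  have := residue_norm_parity k (total (dem boundary_config) A).
  have := residue_norm_max k (total (dem boundary_config) A).
  by move: (residue_norm _ _) => a; clear; lia.
- by rewrite /balance !total0.
Qed.

(** The degree differences in [net] and in the demand cancel, so 4k + 2 divides twice the error of
    the flow at each vertex, and 2k + 1 divides the error. *)
Lemma orientation_flow (o : E -> bool) :
  (forall v, (modulus k %| net boundary_config o v - dem boundary_config v)%Z) ->
  is_flow_with_boundary tail head (fun e => (o e : nat)%:R) beta.
Proof.
move=> ho v; pose flow h : int := \sum_(e | h e == v) (o e : nat)%:Z.
have flowE h : \sum_(e | h e == v) ((o e : nat)%:R : 'Z_n) = (flow h)%:~R.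
  by rewrite rmorph_sum /=; apply: eq_bigr => e _; rewrite -pmulrn.
rewrite !flowE -rmorphB /=.
have -> : beta v = ((beta v : nat)%:Z)%:~R by rewrite -pmulrn natr_Zp.
apply/eqP; rewrite -subr_eq0 -rmorphB; apply/eqP/intr_Zp_dvd.
have flow_net h : flow h = \sum_(e in setT) (o e : nat)%:Z * (h e == v)%:Z.
  rewrite /flow big_mkcond [RHS](eq_bigl predT) => [|e]; last by rewrite inE.
  by apply: eq_bigr => e _; case: eqP; rewrite ?mulr1 ?mulr0.
have netE : net boundary_config o v = 2 * (flow tail - flow head) -
    (end_count setT tail v - end_count setT head v).
  rewrite !flow_net /net /end_count -!sumrB big_distrr /= -sumrB.
  by apply: eq_bigr => e _; case: (o e); rewrite /direction /=; clear; lia.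
have := ho v; rewrite netE /=; case/dvdzP=> j hj; apply/dvdzP; exists j.
by move: hj; rewrite /modulus; clear; lia.
Qed.

End FlowFromOrientation.

Theorem theorem11 (k : nat) (V E : finType) (tail head : E -> V) :
  (1 <= k)%N ->
  loopless tail head ->
  edge_connected tail head (6 * k) ->
  forall beta : V -> 'Z_(2 * k + 1),
    is_boundary beta ->
    exists f : E -> 'Z_(2 * k + 1),
      is_flow_with_boundary tail head f beta /\
      (forall e : E, f e = 0 \/ f e = 1).
Proof.
move=> k0 _ conn beta hbeta.
have [o ho] := valid_orientable k0 (boundary_config_valid k0 hbeta conn).
exists (fun e => (o e : nat)%:R); split.
  by apply: (orientation_flow k0) => v; apply: ho; rewrite inE.
by move=> e; case: (o e); [right | left].
Qed.
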